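(* Let $m$ be a positive integer and let $R^m:\mathbb{S}\to\mathbb{S}$ be the $m$th power operator $R^m(x)=\{t_n^m\}_{n=1}^\infty$ for $x=\{t_n\}_{n=1}^\infty\in\mathbb{S}$. Then $R^m$ is Fréchet differentiable on $\mathbb{S}$, and for every $\bar x=(\bar t_1,\bar t_2,\ldots)\in\mathbb{S}$ the Fréchet derivative $\nabla(R^m)(\bar x)$ has the following representation. (i) If $m>1$, then $\nabla(R^m)(\bar x)$ is the infinite diagonal matrix with diagonal entries $m\bar t_1^{\,m-1},m\bar t_2^{\,m-1},\ldots$, i.e. the pointwise multiplication operator on $\mathbb{S}$ with $\nabla(R^m)(\bar x)(x)=\{m\bar t_n^{\,m-1}t_n\}_{n=1}^\infty\in\mathbb{S}$ for every $x=\{t_n\}_{n=1}^\infty\in\mathbb{S}$. (ii) If $m=1$, then $\nabla(R)(\bar x)$ (with $R=R^1$) is the infinite identity matrix, i.e. $\nabla(R)(\bar x)(x)=x$ for every $x\in\mathbb{S}$.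
   Context: $\mathbb{S}$ is the real vector space of all sequences of real numbers. For $k=1,2,\ldots$ define the $F$-seminorm $\|x\|_k=\frac{|t_k|}{1+|t_k|}$ for $x=\{t_n\}_{n=1}^\infty\in\mathbb{S}$. $\mathbb{S}$ carries the topology $\tau_{\mathbb{S}}$ induced by the family $\mathbb{F}_{\mathbb{S}}=\{\|\cdot\|_k:k=1,2,\ldots\}$, i.e. the sets $\{x:\max\{p(x-x_0):p\in I\}<\lambda\}$, with $I$ a nonempty finite subset of $\mathbb{F}_{\mathbb{S}}$ and $\lambda>0$, form a base of neighborhoods of $x_0$. $\mathcal{F}_{\mathbb{S}}$ is the collection of nonempty finite subsets of $\mathbb{F}_{\mathbb{S}}$. Fréchet differentiability is with respect to this family: for $T:\mathbb{S}\to\mathbb{S}$ and $\bar x\in\mathbb{S}$, $T$ is Fréchet differentiable at $\bar x$ with Fréchet derivative $\nabla T(\bar x)=A$ if $A:\mathbb{S}\to\mathbb{S}$ is a continuous linear mapping such that for every $J\in\mathcal{F}_{\mathbb{S}}$ and $\varepsilon>0$ there are $I\in\mathcal{F}_{\mathbb{S}}$ and $\delta>0$ such that for all $u\in\mathbb{S}$: (DZ) if $\max\{p(u):p\in I\}=0$ then $\max\{q(T(\bar x+u)-T(\bar x)-A(u)):q\in J\}=0$; and (DR) if $0<\max\{p(u):p\in I\}<\delta$ then $\max\left\{q\left(\frac{T(\bar x+u)-T(\bar x)-A(u)}{\max\{p(u):p\in I\}}\right):q\in J\right\}<\varepsilon$. The equation $\nabla T(\bar x)=A$ is the assertion that $A$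 has these properties. *)

(* Defs.v *)
From HB Require Import structures.
From mathcomp Require Export all_boot all_order all_algebra finmap.
From mathcomp Require Export all_classical all_reals all_analysis.
From mathcomp Require Import lra.
Set Implicit Arguments.
Unset Strict Implicit.
Unset Printing Implicit Defensive.
Export Order.TTheory GRing.Theory Num.Theory numFieldNormedType.Exports.
Local Open Scope classical_set_scope.
Local Open Scope ring_scope.

(* Terms are indexed from 0: [x n] is the term t_{n+1}. The alias carries the
   coordinatewise vector space structure and, below, its own topology. *)
Definition seqS (R : realType) : Type := nat -> R.

HB.instance Definition _ (R : realType) :=
  GRing.Lmodule.copy (seqS R) (nat -> R^o).

Definition Fnorm (R : realType) (k : nat) (x : seqS R) : R :=
  `|x k| / (1 + `|x k|).

Definition FS (R : realType) : set (seqS R -> R) := range (@Fnorm R).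

Definition finFS (R : realType) : set {fset (seqS R -> R)} :=
  [set I | I != fset0 /\ [set` I] `<=` @FS R].

(* On nonempty finite sets of nonnegative functions, the default value 0 does
   not affect the maximum. *)
Definition maxF (R : realType) (I : {fset (seqS R -> R)}) (u : seqS R) : R :=
  \big[Num.max/0]_(p <- I) p u.

Definition ballF (R : realType) (x0 : seqS R) (I : {fset (seqS R -> R)})
    (lambda : R) : set (seqS R) :=
  [set x | maxF I (x - x0) < lambda].

Definition nbhsS (R : realType) (x0 : seqS R) : set_system (seqS R) :=
  [set V | exists I, exists lambda : R,
    [/\ finFS I, 0 < lambda & ballF x0 I lambda `<=` V]].

Section topology.
Variable R : realType.
Implicit Types (x y : seqS R) (I J : {fset (seqS R -> R)}).

Lemma Fnorm_ge0 k x : 0 <= Fnorm k x.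
Proof. by rewrite /Fnorm divr_ge0 // addr_ge0. Qed.

Lemma Fnorm_triangle k x y : Fnorm k (x + y) <= Fnorm k x + Fnorm k y.
Proof.
rewrite /Fnorm; have -> : (x + y) k = x k + y k by [].
have := ler_normD (x k) (y k).
move: `|x k + y k| `|x k| `|y k| (normr_ge0 (x k + y k))
  (normr_ge0 (x k)) (normr_ge0 (y k)) => c a b c0 a0 b0 cab.
have E (t : R) : 0 <= t -> t / (1 + t) = 1 - (1 + t)^-1.
  by move=> t0; rewrite -[X in X - _](@divff _ (1 + t)) ?mulrDl; [lra|lra].
have le1 : c / (1 + c) <= (a + b) / (1 + (a + b)).
  rewrite !E ?addr_ge0// lerD2l lerN2 lef_pV2 ?posrE; lra.
apply: (le_trans le1); rewrite mulrDl.
by apply: lerD; apply: ler_wpM2l => //; rewrite lef_pV2 ?posrE; lra.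
Qed.

Lemma maxF_ltP I u (e : R) : 0 < e ->
  maxF I u < e <-> (forall p, p \in I -> p u < e).
Proof.
move=> e0; rewrite /maxF; split.
  move=> H p pI; apply: le_lt_trans H; exact: le_bigmax_seq.
move=> H; rewrite big_seq; elim/big_ind: _ => // a b ha hb.
by rewrite gt_max ha hb.
Qed.

Lemma ballFP x0 I (e : R) x : 0 < e ->
  ballF x0 I e x <-> (forall p, p \in I -> p (x - x0) < e).
Proof. exact: maxF_ltP. Qed.

Lemma Fnorm0 k : Fnorm k (0 : seqS R) = 0.
Proof. by rewrite /Fnorm [X in `|X|](_ : _ = 0)// normr0 mul0r. Qed.

Lemma ballF_center x0 I (e : R) : finFS I -> 0 < e -> ballF x0 I e x0.
Proof.
move=> [_ IF] e0; apply/ballFP => // p pI.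
by have [k _ <-] := IF p pI; rewrite subrr Fnorm0.
Qed.

Lemma finFS1 : finFS [fset @Fnorm R 0]%fset.
Proof.
split; last by move=> p /=; rewrite inE => /eqP ->; exists 0%N.
by apply/fset0Pn; exists (@Fnorm R 0); rewrite inE.
Qed.

Lemma finFSU I J : finFS I -> finFS J -> finFS (I `|` J)%fset.
Proof.
move=> [I0 IF] [_ JF]; split.
  by case/fset0Pn: I0 => p pI; apply/fset0Pn; exists p; rewrite inE pI.
by move=> p /=; rewrite inE => /orP[]; [exact: IF|exact: JF].
Qed.

Lemma nbhsS_filter x0 : ProperFilter (nbhsS x0).
Proof.
split.
  by move=> [I [e [FI e0 sub]]]; exact: (sub x0 (ballF_center x0 FI e0)).
split.
- by exists [fset @Fnorm R 0]%fset, 1; split => //; exact: finFS1.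
- move=> P Q [I [e [FI e0 IP]]] [J [d [FJ d0 JQ]]].
  exists (I `|` J)%fset, (Num.min e d); split.
  + exact: finFSU.
  + by rewrite lt_min e0 d0.
  + have m0 : 0 < Num.min e d by rewrite lt_min e0 d0.
    move=> x /(ballFP _ _ _ m0) H; split.
      apply/IP/ballFP => // p pI.
      by have := H p; rewrite inE pI lt_min => /(_ isT)/andP[].
    apply/JQ/ballFP => // p pJ.
    by have := H p; rewrite inE pJ orbT lt_min => /(_ isT)/andP[].
- by move=> P Q PQ [I [e [FI e0 IP]]]; exists I, e; split => // x /IP/PQ.
Qed.

Lemma nbhsS_singleton x0 (A : set (seqS R)) : nbhsS x0 A -> A x0.
Proof. by move=> [I [e [FI e0 sub]]]; exact/sub/ballF_center. Qed.

Lemma nbhsS_nbhsS x0 (A : set (seqS R)) :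
  nbhsS x0 A -> nbhsS x0 (fun y => nbhsS y A).
Proof.
move=> [I [e [FI e0 sub]]]; have e20 : 0 < e / 2 by rewrite divr_gt0.
exists I, (e / 2); split => // y /(ballFP _ _ _ e20) Hy.
exists I, (e / 2); split => // z /(ballFP _ _ _ e20) Hz.
apply/sub/ballFP => // p pI.
have := Hy p pI; have := Hz p pI; have [k _ <-] := FI.2 p pI => hz hy.
have -> : z - x0 = (z - y) + (y - x0) by rewrite addrA subrK.
by apply: le_lt_trans (Fnorm_triangle _ _ _) _; lra.
Qed.

End topology.

HB.instance Definition _ (R : realType) := hasNbhs.Build (seqS R) (@nbhsS R).

HB.instance Definition _ (R : realType) :=
  Nbhs_isNbhsTopological.Build (seqS R)
    (@nbhsS_filter R) (@nbhsS_singleton R) (@nbhsS_nbhsS R).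

Definition is_frechet_derivative (R : realType) (T : seqS R -> seqS R)
    (xbar : seqS R) (A : seqS R -> seqS R) : Prop :=
  [/\ linear A, continuous A &
   forall J (eps : R), finFS J -> 0 < eps ->
   exists I, exists delta : R, [/\ finFS I, 0 < delta &
   forall u : seqS R,
     (maxF I u = 0 -> maxF J (T (xbar + u) - T xbar - A u) = 0) /\
     (0 < maxF I u < delta ->
      maxF J ((maxF I u)^-1 *: (T (xbar + u) - T xbar - A u)) < eps)]].

Definition frechet_differentiable (R : realType) (T : seqS R -> seqS R)
    (xbar : seqS R) : Prop :=
  exists A, is_frechet_derivative T xbar A.

Definition powS (R : realType) (m : nat) (x : seqS R) : seqS R :=
  fun n => x n ^+ m.

Definition mulS (R : realType) (d x : seqS R) : seqS R :=
  fun n => d n * x n.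

Definition diag_infmx (R : realType) (d : seqS R) (i j : nat) : R :=
  if i == j then d i else 0.

(* The i-th term of [A x] is the sum of the convergent series
   M i 0 * x 0 + M i 1 * x 1 + ... *)
Definition represented_by (R : realType) (A : seqS R -> seqS R)
    (M : nat -> nat -> R) : Prop :=
  forall (x : seqS R) (i : nat),
    series (fun j => M i j * x j : R) @ \oo --> (A x i : R).

(* Main.v *)
(** Each coordinate of the remainder [(a + t)^m - a^m - m a^(m-1) t] is
    [O(t^2)], with a constant depending on the coordinate only.  A finite family
    [J] of seminorms sees finitely many coordinates, so one constant serves for
    all of them, and both the definition of differentiability and continuity
    of the derivative hold with [I = J]: when [M = max_I p(u) < 1/2] one has
    [|u_k| <= 2 M] for every coordinate [k] seen by [J], and the remainder
    divided by [M] is [O(M)]. *)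
Require Import Defs.
From mathcomp Require Import ring lra.
Set Implicit Arguments.
Unset Strict Implicit.
Unset Printing Implicit Defensive.
Local Open Scope classical_set_scope.
Local Open Scope ring_scope.

Section Fnorm.
Variable R : realType.
Implicit Types (x u : seqS R) (J : {fset (seqS R -> R)}).

(** A seminorm thus determines its coordinate, which lets bounds indexed by coordinates be taken
    over a finite set of seminorms. The [j]-th unit sequence separates them. *)
Lemma Fnorm_inj : injective (@Fnorm R).
Proof.
move=> j k /(congr1 (fun f => f (fun i => (i == j)%:R : R))).
rewrite /Fnorm eqxx normr1; have [->//|_] := eqVneq k j.
by rewrite normr0 mul0r => /eqP; rewrite gt_eqF ?divr_gt0.
Qed.

Lemma Fnorm_le_norm k x : Fnorm k x <= `|x k|.
Proof.
have t0 := normr_ge0 (x k).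
by rewrite /Fnorm ler_pdivrMr; nra.
Qed.

(** If [s = t / (1 + t)] then [t = s / (1 - s)], and [1 - s] is at least [1 / 2]. *)
Lemma norm_le_Fnorm k x : Fnorm k x <= 1 / 2 -> `|x k| <= 2 * Fnorm k x.
Proof.
rewrite /Fnorm; have t0 := normr_ge0 (x k).
have p : 0 < 1 + `|x k| by lra.
by rewrite ler_pdivrMr// mulrA ler_pdivlMr//; nra.
Qed.

Lemma Fnorm_mulS (d : seqS R) k x (D : R) : 1 <= D -> `|d k| <= D ->
  Fnorm k (mulS d x) <= D * Fnorm k x.
Proof.
move=> D1 dD; rewrite /Fnorm /mulS normrM.
have s0 := normr_ge0 (d k); have t0 := normr_ge0 (x k).
have p : 0 < 1 + `|x k| by lra.
have st0 : 0 <= `|d k| * `|x k| by rewrite mulr_ge0.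
rewrite ler_pdivrMr; last by lra.
rewrite mulrA mulrAC ler_pdivlMr//.
move: `|d k| `|x k| s0 t0 dD {p} st0 => s t s0 t0 sD st0.
(* After cross-multiplication the difference of the two sides is exactly the sum of this product and
   the next. *)
have : 0 <= (D - s) * t by rewrite mulr_ge0 ?subr_ge0.
have : 0 <= (D - 1) * t * (s * t) by rewrite !mulr_ge0 ?subr_ge0.
by nra.
Qed.

Lemma finFS_bounded J (f : nat -> R) :
  exists C, 1 <= C /\ forall k, Fnorm k \in J -> f k <= C.
Proof.
(* Turns [f] into a function of the seminorm; outside [FS] the bound is vacuous. *)
have /choice[c cP] : forall p, exists b, forall k, p = @Fnorm R k -> f k <= b.
  move=> p; have [[k _ <-]|np] := pselect (FS p).
    by exists (f k) => j /Fnorm_inj ->.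
  by exists 0 => k pk; case: np; exists k.
exists (\big[Num.max/1]_(p <- J) c p); split; first exact: bigmax_ge_id.
by move=> k kJ; apply: le_trans (cP _ k erefl) _; apply: le_bigmax_seq.
Qed.

Lemma maxF_ge0 J u : 0 <= maxF J u.
Proof. exact: bigmax_ge_id. Qed.

Lemma Fnorm_le_maxF J u k : Fnorm k \in J -> Fnorm k u <= maxF J u.
Proof. by move=> kJ; apply: le_bigmax_seq kJ _. Qed.

Lemma maxF_lt J u (e : R) : finFS J -> 0 < e ->
  (forall k, Fnorm k \in J -> Fnorm k u < e) -> maxF J u < e.
Proof.
move=> [_ JF] e0 H; apply/maxF_ltP => // p pJ.
by have [k _ pk] := JF p pJ; rewrite -pk; apply: H; rewrite pk.
Qed.

End Fnorm.

Section mulS.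
Variable R : realType.
Implicit Types d x : seqS R.

Lemma mulS_linear d : linear (mulS d).
Proof.
move=> a x y; apply/funext => n.
by rewrite /mulS [LHS]mulrDr [X in X + _]mulrCA.
Qed.

Lemma mulS_continuous d : continuous (mulS d).
Proof.
move=> x V [J [e [FJ e0 JV]]].
have [D [D1 dD]] := finFS_bounded J (fun k => `|d k|).
have D0 : 0 < D by lra.
exists J, (e / D); split => //; first exact: divr_gt0.
move=> y yJ; apply: JV; apply: maxF_lt => // k kJ.
have -> : mulS d y - mulS d x = mulS d (y - x).
  by apply/funext => n; rewrite /mulS [RHS]mulrBr.
apply: le_lt_trans (Fnorm_mulS _ D1 (dD k kJ)) _.
by rewrite mulrC -ltr_pdivlMr//; apply: le_lt_trans (Fnorm_le_maxF _ kJ) yJ.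
Qed.

Lemma mulS_represented d : represented_by (mulS d) (diag_infmx d).
Proof.
(* The partial sums are constant once they include index [i], that is, from length [i.+1] on. *)
move=> x i; apply: cvg_near_cst; exists i.+1 => // n /= ni.
rewrite /series /= big_mkord (bigD1 (Ordinal ni))//= /diag_infmx eqxx.
rewrite big1 ?addr0// => j; rewrite -val_eqE /= eq_sym => /negPf ->.
by rewrite mul0r.
Qed.

End mulS.

(** Induction on [m]: the remainders satisfy [r_(m+1) = (a + t) * r_m + m * a^(m-1) * t^2], and
    [|a + t| <= |a| + 1]. *)
Lemma expr_taylor1 (R : realType) (m : nat) (a : R) :
  exists C, forall t, `|t| <= 1 ->
    `|(a + t) ^+ m - a ^+ m - m%:R * a ^+ (m - 1) * t| <= C * `|t| ^+ 2.
Proof.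
elim: m => [|m [C IH]].
  by exists 0 => t _; rewrite !expr0 subrr !mul0r subrr normr0.
exists ((`|a| + 1) * C + `|m%:R * a ^+ (m - 1)|) => t t1.
(* At [m = 0] the subtraction truncates, but the factor [m%:R] makes both sides vanish. *)
have am : m%:R * a ^+ m = a * (m%:R * a ^+ (m - 1)).
  by case: (m) => [|n]; rewrite ?mul0r ?mulr0// subn1 /= exprS; ring.
have -> : (a + t) ^+ m.+1 - a ^+ m.+1 - m.+1%:R * a ^+ (m.+1 - 1) * t =
    (a + t) * ((a + t) ^+ m - a ^+ m - m%:R * a ^+ (m - 1) * t)
    + m%:R * a ^+ (m - 1) * t ^+ 2.
  rewrite subSS subn0 !exprS -natr1.
  transitivity ((a + t) * (a + t) ^+ m - a * a ^+ m - (m%:R * a ^+ m + a ^+ m) * t).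
    by ring.
  by rewrite am; ring.
rewrite [leRHS]mulrDl -[in leRHS]mulrA; apply: le_trans (ler_normD _ _) _.
rewrite (normrM (a + t)) (normrM (m%:R * _)) normrX lerD2r.
apply: ler_pM => //; last exact: IH.
by apply: le_trans (ler_normD _ _) _; rewrite lerD2l.
Qed.

Lemma powS_frechet (R : realType) (m : nat) (xbar : seqS R) :
  is_frechet_derivative (powS m) xbar
    (mulS (fun n => m%:R * xbar n ^+ (m - 1))).
Proof.
split; [exact: mulS_linear|exact: mulS_continuous|].
move=> J eps FJ eps0.
have /choice[c cP] := fun k => expr_taylor1 m (xbar k).
have [C [C1 cC]] := finFS_bounded J c.
have C0 : 0 < 4 * C by lra.
set A := mulS _.
have rem u k : Fnorm k \in J -> maxF J u <= 1 / 2 ->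
    `|(powS m (xbar + u) - powS m xbar - A u) k| <= 4 * C * maxF J u ^+ 2.
  move=> kJ M2; have kM := Fnorm_le_maxF u kJ.
  have := norm_le_Fnorm (le_trans kM M2) => uM.
  have t0 := normr_ge0 (u k).
  (* The Taylor bound applies since [|u k| <= 2 * Fnorm k u <= 1]. *)
  apply: le_trans (cP k (u k) _) _; first by lra.
  have := cC k kJ => ck.
  apply: (@le_trans _ _ (C * `|u k| ^+ 2)); first by rewrite ler_wpM2r ?exprn_ge0.
  have : `|u k| ^+ 2 <= (2 * maxF J u) ^+ 2 by rewrite lerXn2r ?nnegrE; lra.
  by rewrite exprMn; nra.
(* The first bound enables [rem]; the second makes [4 * C * M < eps], where [M = maxF J u]. *)
exists J, (Num.min (1 / 2) (eps / (4 * C))); split => //.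
  by rewrite lt_min divr_gt0// divr_gt0.
move=> u; split.
  move=> M0; apply/eqP; rewrite eq_le maxF_ge0 andbT.
  (* [maxF_lt] yields strict bounds only, so the maximum is shown to be below every positive [e]. *)
  apply/ler_addgt0Pr => e e0; rewrite add0r; apply/ltW/maxF_lt => // k kJ.
  apply: le_lt_trans (Fnorm_le_norm _ _) _.
  by apply: le_lt_trans (rem _ _ kJ _) _; rewrite M0 ?expr0n ?mulr0//; lra.
rewrite lt_min => /and3P[M0 M2 Meps].
apply: maxF_lt => // k kJ.
apply: le_lt_trans (Fnorm_le_norm _ _) _.
rewrite [X in `|X|](_ : _ =
  (maxF J u)^-1 * (powS m (xbar + u) - powS m xbar - A u) k)//.
rewrite normrM gtr0_norm ?invr_gt0// mulrC ltr_pdivrMr//.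
apply: le_lt_trans (rem _ _ kJ (ltW M2)) _.
by rewrite expr2 mulrA ltr_pM2r// mulrC -ltr_pdivlMr.
Qed.

Theorem theorem7p2 (R : realType) (m : nat) (m_gt0 : (0 < m)%N) :
  (forall xbar : seqS R, frechet_differentiable (powS m) xbar) /\
  (forall xbar : seqS R,
    ((1 < m)%N ->
       let d : seqS R := fun n => m%:R * xbar n ^+ (m - 1) in
       is_frechet_derivative (powS m) xbar (mulS d) /\
       represented_by (mulS d) (diag_infmx d)) /\
    (m = 1%N ->
       is_frechet_derivative (powS m) xbar (fun x => x) /\
       represented_by (fun x : seqS R => x) (diag_infmx (fun=> 1)))).
Proof.
split=> xbar; first by eexists; exact: powS_frechet.
split=> [_ d|->]; first by split; [exact: powS_frechet|exact: mulS_represented].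
(* For [m = 1] the diagonal [1 * xbar n ^+ 0] is constantly 1, even where [xbar n = 0]. *)
have mulS1 : mulS (fun=> 1) = (fun x : seqS R => x).
  by apply/funext => x; apply/funext => n; rewrite /mulS mul1r.
rewrite -mulS1; split; last exact: mulS_represented.
have := powS_frechet 1 xbar.
by under [X in mulS X]eq_fun do rewrite expr0 mulr1.
Qed.
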